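(* Let $(X,\mathcal{A},\mu)$ be a measure space. The $U_\mu$-topology and the $m_\mu$-topology on $\mathcal{M}(X,\mathcal{A})$ coincide if and only if each function in $\mathcal{M}(X,\mathcal{A})$ is essentially bounded, i.e., $\mathcal{M}(X,\mathcal{A})=L^\infty(X,\mathcal{A},\mu)$.
   Context: $X$ is a non-empty set, $\mathcal{A}$ a $\sigma$-algebra on $X$, $\mu:\mathcal{A}\to[0,\infty]$ a measure. $\mathcal{M}(X,\mathcal{A})$ is the commutative ring of all measurable functions $X\to\mathbb{R}$ under pointwise operations. A $\mu$-null set is a set $E\in\mathcal{A}$ with $\mu(E)=0$. A positive unit of $\mathcal{M}(X,\mathcal{A})$ is a $u\in\mathcal{M}(X,\mathcal{A})$ with $u(x)>0$ for all $x\in X$. The $U_\mu$-topology on $\mathcal{M}(X,\mathcal{A})$ has as open base the sets $U_\mu(f,\epsilon)=\{g\in\mathcal{M}(X,\mathcal{A}): \sup_{x\in X\setminus E}|f(x)-g(x)|<\epsilon$ for some $\mu$-null set $E\}$ (supremum taken in $[0,\infty]$), $f\in\mathcal{M}(X,\mathcal{A})$, $\epsilon>0$. The $m_\mu$-topology has as open base the sets $m_\mu(f,u)=\{g\in\mathcal{M}(X,\mathcal{A}):$ there is a $\mu$-null set $E$ with $|f(x)-g(x)|<u(x)$ for all $x\in X\setminus E\}$, $f\in\mathcal{M}(X,\mathcal{A})$, $u$ a positive unit. $L^\infty(X,\mathcal{A},\mu)$ denotes the set of all essentially bounded $f\in\mathcal{M}(X,\mathcal{A})$, i.e. those for which there is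 a $\mu$-null set $E$ such that $f$ is bounded on $X\setminus E$. *)

(* Defs.v *)
From HB Require Import structures.
From mathcomp Require Import all_boot all_order all_algebra.
From mathcomp Require Import all_classical all_reals all_analysis.
(* not exported by all_analysis; provides the ring structure on {mfun T >-> R} *)
From mathcomp Require Import measurable_realfun.
Set Implicit Arguments.
Unset Strict Implicit.
Unset Printing Implicit Defensive.
Import Order.TTheory GRing.Theory Num.Theory.
Import numFieldNormedType.Exports.
Local Open Scope classical_set_scope.
Local Open Scope ring_scope.

(* [measurableType]s are pointed, so the underlying set X is non-empty.
   M(X, A) is the library's comNzRingType {mfun T >-> R}, where R carries its
   Borel sigma-algebra. *)

Section definitions.
Context d (T : measurableType d) (R : realType).
Variable mu : {measure set T -> \bar R}.
Implicit Types (f g u : {mfun T >-> R}) (e : R) (E : set T).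

(* The library's [mu.-negligible] also admits non-measurable subsets of null
   sets; here a null set must itself be measurable. *)
Definition mu_null E : Prop := measurable E /\ mu E = 0%E.

Definition positive_unit u : Prop := forall x, 0 < u x.

(* The supremum is taken in [0, +oo]; [ereal_sup] differs from it only on the
   empty set (-oo instead of 0), when E is the whole space, and both values are
   then < e since U_ball is only used with 0 < e. *)
Definition U_ball f e : set {mfun T >-> R} :=
  [set g | exists2 E, mu_null E &
     (ereal_sup [set `|f x - g x|%:E | x in ~` E] < e%:E)%E].

Definition m_ball f u : set {mfun T >-> R} :=
  [set g | exists2 E, mu_null E & forall x, (~` E) x -> `|f x - g x| < u x].

Definition U_base : set (set {mfun T >-> R}) :=
  [set V | exists f e, 0 < e /\ V = U_ball f e].

Definition m_base : set (set {mfun T >-> R}) :=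
  [set V | exists f u, positive_unit u /\ V = m_ball f u].

Definition ess_bounded f : Prop :=
  exists2 E, mu_null E & [bounded f x | x in ~` E].

Definition Linfty : set {mfun T >-> R} := [set f | ess_bounded f].

Lemma mu_null0 : mu_null set0.
Proof. by split; [exact: measurable0|exact: measure0]. Qed.

Lemma mu_nullU E F : mu_null E -> mu_null F -> mu_null (E `|` F).
Proof.
move=> [mE E0] [mF F0]; split; first exact: measurableU.
by rewrite null_set_setU.
Qed.

Lemma U_ballP f e g : U_ball f e g <->
  exists2 E, mu_null E &
    exists2 r, r < e & forall x, (~` E) x -> `|f x - g x| <= r.
Proof.
split=> [[E E0 supe]|[E E0 [r re fgr]]]; exists E => //; last first.
  apply: (@le_lt_trans _ _ r%:E); last by rewrite lte_fin.
  by apply: ge_ereal_sup => _ [x Ex <-]; rewrite lee_fin fgr.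
have ub x : (~` E) x ->
    (`|f x - g x|%:E <= ereal_sup [set `|f x - g x|%:E | x in ~` E])%E.
  by move=> Ex; apply: ereal_sup_ubound; exists x.
move: (ereal_sup _) supe ub => [r| |] // supe ub.
  by exists r; [rewrite -lte_fin|move=> x /ub; rewrite lee_fin].
by exists (e - 1); [rewrite ltrBlDr ltrDl|move=> x /ub].
Qed.

Lemma U_ball_center f e : 0 < e -> U_ball f e f.
Proof.
move=> e0; apply/U_ballP; exists set0; first exact: mu_null0.
by exists 0 => // x _; rewrite subrr normr0.
Qed.

Lemma m_ball_center f u : positive_unit u -> m_ball f u f.
Proof.
by move=> u0; exists set0; [exact: mu_null0|move=> x _; rewrite subrr normr0].
Qed.

Lemma U_base_cover : \bigcup_(V in U_base) V = setT.
Proof.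
rewrite -subTset => f _; exists (U_ball f 1); last exact: U_ball_center.
by exists f, 1.
Qed.

Lemma m_base_cover : \bigcup_(V in m_base) V = setT.
Proof.
rewrite -subTset => f _; have p1 : positive_unit 1 by move=> x; exact: ltr01.
by exists (m_ball f 1); [exists f, 1|exact: m_ball_center].
Qed.

Lemma U_base_join (V W : set {mfun T >-> R}) h :
  U_base V -> U_base W -> V h -> W h ->
  exists K, [/\ U_base K, K h & K `<=` V `&` W].
Proof.
move=> [f [a [a0 ->]]] [g [b [b0 ->]]].
move=> /U_ballP[E E0 [r ra fr]] /U_ballP[F F0 [s sb gs]].
have e0 : 0 < Num.min (a - r) (b - s) by rewrite lt_min !subr_gt0 ra sb.
exists (U_ball h (Num.min (a - r) (b - s))); split.
- by exists h, (Num.min (a - r) (b - s)).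
- exact: U_ball_center.
- move=> k /U_ballP[G G0 [t]]; rewrite lt_min => /andP[tr ts] ht.
  split; apply/U_ballP.
  + exists (E `|` G); first exact: mu_nullU.
    exists (r + t); first by rewrite addrC -ltrBrDr.
    move=> x; rewrite setCU => -[Ex Gx].
    by rewrite -(subrKA (h x)) (le_trans (ler_normD _ _))// lerD ?fr ?ht.
  + exists (F `|` G); first exact: mu_nullU.
    exists (s + t); first by rewrite addrC -ltrBrDr.
    move=> x; rewrite setCU => -[Fx Gx].
    by rewrite -(subrKA (h x)) (le_trans (ler_normD _ _))// lerD ?gs ?ht.
Qed.

Lemma m_base_join (V W : set {mfun T >-> R}) h :
  m_base V -> m_base W -> V h -> W h ->
  exists K, [/\ m_base K, K h & K `<=` V `&` W].
Proof.
move=> [f [u [u0 ->]]] [g [v [v0 ->]]] [E E0 fu] [F F0 gv].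
pose w0 x := Num.min (u x - `|f x - h x|) (v x - `|g x - h x|).
have mw0 : measurable_fun setT w0.
  apply: measurable_minr; apply: measurable_funB => //;
    by apply: measurableT_comp => //; exact: measurable_funB.
pose w1 x := if 0 < w0 x then w0 x else 1.
have mw1 : measurable_fun setT w1.
  by apply: measurable_fun_ifT => //; exact: measurable_fun_ltr.
pose w : {mfun T >-> R} := mfun_Sub (mem_set mw1 : w1 \in mfun).
have wp : positive_unit w.
  by move=> x; change (0 < w1 x); rewrite /w1; case: ifPn.
have wE x : (~` E) x -> (~` F) x -> w x = w0 x.
  move=> Ex Fx; change (w1 x = w0 x); rewrite /w1 ifT//.
  by rewrite /w0 lt_min !subr_gt0 fu ?gv.
exists (m_ball h w); split; [by exists h, w|exact: m_ball_center|].
move=> k [G G0 hk]; split; exists (E `|` F `|` G);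
  [exact/mu_nullU/G0/mu_nullU| |exact/mu_nullU/G0/mu_nullU|];
  move=> x; rewrite !setCU => -[[Ex Fx] Gx];
  rewrite -(subrKA (h x)) (le_lt_trans (ler_normD _ _))// addrC -ltrBrDr;
  by rewrite (lt_le_trans (hk _ Gx))// wE// /w0 ge_min lexx ?orbT.
Qed.

(* Copies of M(X, A) carrying the two topologies. *)
Definition U_space of {measure set T -> \bar R} : Type := {mfun T >-> R}.
Definition m_space of {measure set T -> \bar R} : Type := {mfun T >-> R}.

HB.instance Definition _ := Choice.copy (U_space mu) {mfun T >-> R}.
HB.instance Definition _ := Choice.copy (m_space mu) {mfun T >-> R}.

HB.instance Definition _ := @isBaseTopological.Build (U_space mu)
  (set {mfun T >-> R}) U_base id U_base_cover U_base_join.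
HB.instance Definition _ := @isBaseTopological.Build (m_space mu)
  (set {mfun T >-> R}) m_base id m_base_cover m_base_join.

Definition U_topology : set (set {mfun T >-> R}) := @open (U_space mu).
Definition m_topology : set (set {mfun T >-> R}) := @open (m_space mu).

Lemma U_topologyE :
  U_topology = [set \bigcup_(V in B) V | B in subset^~ U_base].
Proof. by []. Qed.

Lemma m_topologyE :
  m_topology = [set \bigcup_(V in B) V | B in subset^~ m_base].
Proof. by []. Qed.

End definitions.

(* Main.v *)
Require Import Defs.
From mathcomp Require Import all_boot all_order all_algebra.
From mathcomp Require Import all_classical all_reals all_analysis.
From mathcomp Require Import measurable_realfun.
Import Order.TTheory GRing.Theory Num.Theory.
Local Open Scope classical_set_scope.
Local Open Scope ring_scope.

(** Constants are positive units, so every [U_mu]-open set is [m_mu]-open.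
    A positive unit [w] is [expR (ln w)]; if [ln w] is essentially bounded by
    [M] then [w] is essentially at least [expR (- M)], so [m_mu]-balls contain
    [U_mu]-balls. Conversely, a [U_mu]-neighbourhood of [0] contained in the
    [m_mu]-ball of radius [expR (- |f|)] contains a positive constant [c], and
    [c < expR (- |f|)] almost everywhere bounds [|f|] by [- ln c]. *)

Lemma sub_unions_of_base (T : Type) (B B' : set (set T)) :
  (forall V x, B V -> V x -> exists W, [/\ B' W, W x & W `<=` V]) ->
  [set \bigcup_(V in C) V | C in subset^~ B] `<=`
  [set \bigcup_(V in C) V | C in subset^~ B'].
Proof.
move=> BB' _ [C CB <-].
(* The union over [C] is recovered as the union of all members of [B'] contained in it. *)
exists [set W | B' W /\ W `<=` \bigcup_(V in C) V]; first by move=> W [].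
apply/seteqP; split=> [x [W [_ WC]] /WC//|x [V CV Vx]].
have [W [B'W Wx WV]] := BB' _ _ (CB _ CV) Vx.
by exists W => //; split=> // y Wy; exists V => //; exact: WV.
Qed.

Section comparison.
Context (d : measure_display) (T : measurableType d) (R : realType).
Variable mu : {measure set T -> \bar R}.
Implicit Types f g u : {mfun T >-> R}.

Lemma ess_boundedP f : ess_bounded mu f <->
  exists2 E, mu_null mu E & exists M, forall x, (~` E) x -> `|f x| <= M.
Proof.
split=> [[E E0 [M [_ fM]]]|[E E0 [M fM]]]; exists E => //.
  (* The library's boundedness only gives the bounds strictly above [M], hence [M + 1]. *)
  by exists (M + 1) => x Ex; apply: fM => //; rewrite ltrDl.
exists M; split=> [|N MN x Ex]; first exact: num_real.
exact: le_trans (fM _ Ex) (ltW MN).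
Qed.

Lemma U_topology_sub_m_topology : U_topology mu `<=` m_topology mu.
Proof.
rewrite U_topologyE m_topologyE; apply: sub_unions_of_base.
move=> _ g [f [e [e0 ->]]] /U_ballP[E E0 [r re fr]].
(* Half of the slack: adding it to [r] still leaves a uniform bound strictly below [e], as [U_ballP]
   demands. *)
have c0 : 0 < (e - r) / 2 by rewrite divr_gt0// subr_gt0.
pose c : {mfun T >-> R} := cst ((e - r) / 2).
have cp : positive_unit c by move=> x; exact: c0.
exists (m_ball mu g c); split; [by exists g, c|exact: m_ball_center|].
move=> h [F F0 gh]; apply/U_ballP; exists (E `|` F); first exact: mu_nullU.
exists (r + (e - r) / 2).
  by rewrite -ltrBrDl ltr_pdivrMr// mulr_natr mulr2n ltrDl subr_gt0.
move=> x; rewrite setCU => -[Ex Fx].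
rewrite -(subrKA (g x)) (le_trans (ler_normD _ _))// lerD ?fr//.
exact/ltW/gh.
Qed.

(** The slack [u - |f - g|] serves as radius around [g], by the triangle inequality. This reduces
    the comparison of the topologies to balls around their centres. *)
Lemma m_ball_recenter f u g : m_ball mu f u g ->
  exists2 w : {mfun T >-> R}, positive_unit w & m_ball mu g w `<=` m_ball mu f u.
Proof.
move=> [E E0 fg].
pose w0 x := u x - `|f x - g x|.
have mw0 : measurable_fun setT w0.
  apply: measurable_funB => //.
  by apply: measurableT_comp => //; exact: measurable_funB.
(* The slack may fail to be positive on the null set [E]; the value 1 there makes it a positive
   unit, and [E] is discarded anyway. *)
pose w1 x := if 0 < w0 x then w0 x else 1.
have mw1 : measurable_fun setT w1.
  by apply: measurable_fun_ifT => //; exact: measurable_fun_ltr.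
pose w : {mfun T >-> R} := mfun_Sub (mem_set mw1 : w1 \in mfun).
exists w; first by move=> x; change (0 < w1 x); rewrite /w1; case: ifPn.
move=> h [F F0 gh]; exists (E `|` F); first exact: mu_nullU.
move=> x; rewrite setCU => -[Ex Fx].
rewrite -(subrKA (g x)) (le_lt_trans (ler_normD _ _))// addrC -ltrBrDr.
have wE : w x = w0 x by change (w1 x = w0 x); rewrite /w1 ifT// subr_gt0 fg.
by have := gh _ Fx; rewrite wE.
Qed.

Lemma U_ball_sub_m_ball g u : positive_unit u ->
  [set: {mfun T >-> R}] = Linfty mu ->
  exists2 e, 0 < e & U_ball mu g e `<=` m_ball mu g u.
Proof.
move=> u0 bnd.
have ml : measurable_fun setT (@ln R \o u) by exact: measurableT_comp.
pose l : {mfun T >-> R} := mfun_Sub (mem_set ml : _ \in mfun).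
have : Linfty mu l by rewrite -bnd.
move=> /ess_boundedP[E E0 [M lM]]; exists (expR (- M)); first exact: expR_gt0.
move=> h /U_ballP[F F0 [r rM gh]]; exists (E `|` F); first exact: mu_nullU.
move=> x; rewrite setCU => -[Ex Fx].
(* The chain is [|g x - h x| <= r < expR (- M) <= expR (ln (u x)) = u x]. *)
rewrite (le_lt_trans (gh _ Fx))// (lt_le_trans rM)//.
rewrite -[u x]lnK ?posrE// ler_expR.
by have := lM _ Ex; rewrite ler_norml => /andP[].
Qed.

Lemma m_topology_sub_U_topology :
  [set: {mfun T >-> R}] = Linfty mu -> m_topology mu `<=` U_topology mu.
Proof.
move=> bnd; rewrite U_topologyE m_topologyE; apply: sub_unions_of_base.
move=> _ g [f [u [_ ->]]] /m_ball_recenter[w w0 wu].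
have [e e0 ew] := U_ball_sub_m_ball g w w0 bnd.
exists (U_ball mu g e); split; [by exists g, e|exact: U_ball_center|].
exact: subset_trans wu.
Qed.

Lemma ess_bounded_of_m_topology_sub f :
  m_topology mu `<=` U_topology mu -> ess_bounded mu f.
Proof.
move=> mU.
have mexp : measurable_fun setT (fun x => expR (- `|f x|)).
  apply: measurableT_comp => //; apply: measurableT_comp => //.
  exact: measurableT_comp.
pose u : {mfun T >-> R} := mfun_Sub (mem_set mexp : _ \in mfun).
have u0 : positive_unit u by move=> x; exact: expR_gt0.
have : U_topology mu (m_ball mu 0 u).
  apply: mU; rewrite m_topologyE; exists [set m_ball mu 0 u].
    by move=> _ ->; exists 0, u.
  by rewrite bigcup_set1.
rewrite U_topologyE => -[C CB Cu].
have := m_ball_center mu 0 u0; rewrite -{1}Cu => -[V CV V0].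
(* The basic set around 0 may be centred at some other [g], with [|g| <= r < e] off [E]. *)
have {V CV V0} [g [e [/U_ballP[E E0 [r re gr]] ge]]] :
    exists g e, U_ball mu g e 0 /\ U_ball mu g e `<=` m_ball mu 0 u.
  have [g [e [_ Ve]]] := CB _ CV; exists g, e; rewrite -Ve; split=> //.
  by move=> h Vh; rewrite -Cu; exists V.
(* A constant this small stays in the ball around [g], since [|g - c| <= r + c < e] off [E]. *)
have c0 : 0 < (e - r) / 2 by rewrite divr_gt0// subr_gt0.
pose c : {mfun T >-> R} := cst ((e - r) / 2).
have /ge[F F0 cu] : U_ball mu g e c.
  apply/U_ballP; exists E => //; exists (r + (e - r) / 2).
    by rewrite -ltrBrDl ltr_pdivrMr// mulr_natr mulr2n ltrDl subr_gt0.
  move=> x Ex; rewrite (le_trans (ler_normB _ _))// lerD//.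
    by have := gr _ Ex; rewrite subr0.
  by change (`|(e - r) / 2| <= (e - r) / 2); rewrite gtr0_norm.
apply/ess_boundedP; exists F => //; exists (- ln ((e - r) / 2)) => x Fx.
rewrite lerNr -ler_expR lnK ?posrE//.
have := cu _ Fx; rewrite sub0r normrN => /ltW.
by apply: le_trans; exact: ler_norm.
Qed.

End comparison.

Theorem corollary2p8 (d : measure_display) (T : measurableType d)
    (R : realType) (mu : {measure set T -> \bar R}) :
  U_topology mu = m_topology mu <-> [set: {mfun T >-> R}] = Linfty mu.
Proof.
split=> [UmE|bnd].
  apply/seteqP; split=> // f _.
  by apply: ess_bounded_of_m_topology_sub; rewrite UmE.
apply/seteqP; split; first exact: U_topology_sub_m_topology.
exact: m_topology_sub_U_topology.
Qed.
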